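(* Suppose that the following hold. (i) $\operatorname{dom}\partial h(\cdot,z)=S$ for all $z\in\Xi$. (ii) $\rho_H+\rho_G>0$. (iii) There is a Borel measurable map $\tau:S\times\Xi\to\mathbb{R}^m$ with $\tau(w,z)\in\partial_w h(w,z)$ for all $w\in S$, $z\in\Xi$, and a Borel measurable function $\tilde\tau$ such that $\tilde\tau(Z)^2$ is integrable and $\|\tau(w,z)\|\le\tilde\tau(z)$ for all $w\in S$, $z\in\Xi$. (iv) $\sup_{w\in S}|F(w)|<+\infty$. Let $\{n_k\}_{k\ge0}$ be a sequence of positive integers with $\sum_{k=1}^{\infty}n_k^{-1}<+\infty$. Let $\{w^k\}_{k\ge0}$ be generated by the online stochastic DCA with exact $G$ described in the context, with sample sizes $\{n_k\}$ and selector $\tau$. Then: 1. There exists an integrable random variable $F^\infty$ such that $F(w^k)\to F^\infty$ almost surely. 2. $\sum_{k=1}^{\infty}\|w^{k+1}-w^k\|^2<+\infty$ almost surely. 3. There exists a measurable set $\mathcal{L}\subset\Omega$ with $\mathbb{P}(\mathcal{L})=1$ such that for each $\omega\in\mathcal{L}$, every limit point of $\{w^k(\omega)\}$ is a critical point of $F=G-H$.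
   Context: Setting. $S\subset\mathbb{R}^m$ is a nonempty, compact, convex set. $(\Omega,\mathcal{M},\mathbb{P})$ is a complete probability space, $Z:\Omega\to\mathbb{R}^n$ is a random vector with distribution $P_Z$, and $\Xi=\operatorname{supp}(P_Z)$ is the (closed) support of $P_Z$, i.e. the set of points all of whose neighborhoods have positive $P_Z$-measure. The functions $g,h:\mathbb{R}^m\times\mathbb{R}^n\to\mathbb{R}\cup\{+\infty\}$ are Borel measurable, are finite on $S\times\Xi$ and equal $+\infty$ outside $S\times\Xi$. For all $w\in S$, $g(w,Z)$ and $h(w,Z)$ are integrable. For all $z\in\Xi$, $g(\cdot,z)$ and $h(\cdot,z)$ are convex and lower semicontinuous on $\mathbb{R}^m$. Put $G(w)=\mathbb{E}(g(w,Z))$ and $H(w)=\mathbb{E}(h(w,Z))$; these have effective domain $S$ (value $+\infty$ outside $S$), are convex, and are assumed lower semicontinuous. Put $F=G-H$ (convention $+\infty-(+\infty)=+\infty$). The underlying problem is $\min_{w\in S}F(w)$. Notation. For a convex function $\theta$ on $\mathbb{R}^m$: $\rho(\theta)=\sup\{\mu\ge0:\theta-\frac{\mu}{2}\|\cdot\|^2\text{ is convex on }\mathbb{R}^m\}$ is the modulus of strong convexity, and $\rho_G=\rho(G)$, $\rho_H=\rho(H)$. For $x_0$ in the effective domain of $\theta$, $\partial\theta(x_0)=\{y:\theta(x)\ge\theta(x_0)+\langle x-x_0,y\rangle\ \forall x\in\mathbb{R}^m\}$; $\operatorname{dom}\partial\theta$ is the set of points where $\partial\theta$ is nonempty; $\partial_w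 h(w,z)$ denotes the subdifferential of $h(\cdot,z)$ at $w$. A point $w^*$ is a critical point of $G-H$ if $\partial G(w^* )\cap\partial H(w^* )\ne\emptyset$. Online stochastic DCA with exact $G$. Choose $w^0\in S$. For $k=0,1,2,\dots$: (1) draw $n_k$ independent samples $Z_{k,1},\dots,Z_{k,n_k}$ from the distribution of $Z$, independent also of the past, i.e. of the $\sigma$-algebra $\mathcal{P}_k$ generated by all samples $Z_{j,i}$ with $j<k$ and by $w^0,\dots,w^k$; (2) set $t^k=\frac1{n_k}\sum_{i=1}^{n_k}\tau(w^k,Z_{k,i})$; (3) choose $w^{k+1}\in\arg\min_{w\in\mathbb{R}^m}\left\{G(w)-\langle t^k,w\rangle\right\}$. The iterates $w^k$ are random vectors (measurable), and the algorithm is well defined on the probability-one event that all samples lie in $\Xi$. *)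

(* Defs.v *)
From HB Require Import structures.
From mathcomp Require Import all_boot all_order all_algebra.
From mathcomp Require Import all_classical all_reals all_analysis.
From mathcomp Require Import measurable_realfun.

Set Implicit Arguments.
Unset Strict Implicit.
Unset Printing Implicit Defensive.

Import Order.TTheory GRing.Theory Num.Theory.
Import numFieldNormedType.Exports.

Local Open Scope classical_set_scope.
Local Open Scope ring_scope.
Local Open Scope ereal_scope.

Notation borel T := (g_sigma_algebraType (@open T)).

Section euclidean.
Context {R : realType} {m : nat}.
Implicit Types u v : 'rV[R]_m.

Definition dot u v : R := (\sum_(i < m) u ord0 i * v ord0 i)%R.

(* The library norm of 'rV[R]_m is the sup norm. *)
Definition enorm u : R := Num.sqrt (dot u u).

End euclidean.

(* Extended-valued convex functions: the functions of interest never take the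
   value -oo, and 0 * +oo = 0. *)
Section convex_analysis.
Context {R : realType} {m : nat}.
Implicit Types (theta : 'rV[R]_m -> \bar R) (x y : 'rV[R]_m).

Definition convex_efun theta :=
  forall x y (t : R), (0 <= t <= 1)%R ->
    theta (t *: x + (1 - t) *: y)%R <= t%:E * theta x + (1 - t)%:E * theta y.

(* The modulus is +oo when every mu is admissible, e.g. if the effective domain
   is a singleton. *)
Definition strong_convexity_modulus theta : \bar R :=
  ereal_sup [set mu%:E | mu in [set mu : R | (0 <= mu)%R /\
    convex_efun (fun x => theta x - (mu / 2 * enorm x ^+ 2)%:E)]].

Definition effective_domain theta : set 'rV[R]_m := [set x | theta x < +oo].

Definition subdifferential theta x0 : set 'rV[R]_m :=
  [set y | effective_domain theta x0 /\
    forall x, theta x0 + (dot (x - x0)%R y)%:E <= theta x].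

Definition dom_subdifferential theta : set 'rV[R]_m :=
  [set x | subdifferential theta x !=set0].

Definition argmin theta : set 'rV[R]_m :=
  [set x | forall y, theta x <= theta y].

(* Addition of the dual scope satisfies +oo + -oo = +oo. *)
Definition dc_difference (G H : 'rV[R]_m -> \bar R) (x : 'rV[R]_m) : \bar R :=
  (G x - H x)%dE.

Definition critical_point (G H : 'rV[R]_m -> \bar R) x :=
  subdifferential G x `&` subdifferential H x !=set0.

End convex_analysis.

Section probability.
Context {d : measure_display} {Omega : measurableType d} {R : realType}.
Variable P : probability Omega R.

(* Open neighborhoods suffice, and are measurable. *)
Definition measure_support {n : nat} (mu : set (borel 'rV[R]_n) -> \bar R) :
    set 'rV[R]_n :=
  [set z | forall U : set 'rV[R]_n, open_nbhs z U -> 0 < mu U].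

Definition independent_systems (A B : set (set Omega)) :=
  forall a b, A a -> B b -> P (a `&` b) = P a * P b.

Definition independent_rvs {d' : measure_display} {T : measurableType d'}
    {I : finType} (X : I -> {RV P >-> T}) :=
  forall (J : {set I}) (B : I -> set T),
    (forall i, i \in J -> measurable (B i)) ->
    P (\bigcap_(i in [set` J]) (X i @^-1` B i)) =
    \prod_(i in J) P (X i @^-1` B i).

Definition identically_distributed {d' : measure_display}
    {T : measurableType d'} (X Y : {RV P >-> T}) :=
  forall B : set T, measurable B -> distribution P X B = distribution P Y B.

End probability.

Section stochastic_dc.
Context {d : measure_display} {Omega : measurableType d} {R : realType}.
Context {m n : nat}.
Variables (P : probability Omega R) (Z : {RV P >-> borel 'rV[R]_n}).

Definition expected_value (g : 'rV[R]_m -> 'rV[R]_n -> \bar R) (w : 'rV[R]_m) :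
    \bar R :=
  \int[P]_x g w (Z x).

Record convex_integrand (S : set 'rV[R]_m)
    (g : 'rV[R]_m -> 'rV[R]_n -> \bar R) : Prop := {
  integrand_measurable :
    measurable_fun [set: borel ('rV[R]_m * 'rV[R]_n)%type]
      (fun p => g p.1 p.2) ;
  integrand_finite : forall w z,
    S w -> measure_support (distribution P Z) z -> g w z \is a fin_num ;
  integrand_pinfty : forall w z,
    ~ (S w /\ measure_support (distribution P Z) z) -> g w z = +oo ;
  integrand_integrable : forall w,
    S w -> P.-integrable [set: Omega] (fun x => g w (Z x)) ;
  integrand_convex : forall z,
    measure_support (distribution P Z) z -> convex_efun (g ^~ z) ;
  integrand_lsc : forall z,
    measure_support (distribution P Z) z -> lower_semicontinuous (g ^~ z) ;
  expected_value_lsc : lower_semicontinuous (expected_value g)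
}.

Variable N : nat -> nat.
Variables (X : forall k, 'I_(N k) -> {RV P >-> borel 'rV[R]_n})
  (w : nat -> {RV P >-> borel 'rV[R]_m}).

(* Generated by the samples drawn before step k and by w 0, ..., w k. *)
Definition past (k : nat) : set (set Omega) :=
  <<s (\bigcup_(j in [set j | (j < k)%N]) \bigcup_(i in [set: 'I_(N j)])
         preimage_set_system [set: Omega] (X (k := j) i) measurable) `|`
      (\bigcup_(j in [set j | (j <= k)%N])
         preimage_set_system [set: Omega] (w j) measurable) >>.

Definition batch (k : nat) : set (set Omega) :=
  <<s \bigcup_(i in [set: 'I_(N k)])
        preimage_set_system [set: Omega] (X (k := k) i) measurable >>.

Definition sample_average (tau : 'rV[R]_m -> 'rV[R]_n -> 'rV[R]_m) (k : nat)
    (x : Omega) : 'rV[R]_m :=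
  ((N k)%:R^-1 *: \sum_(i < N k) tau (w k x) (X i x))%R.

Record online_stochastic_dca (S : set 'rV[R]_m) (G : 'rV[R]_m -> \bar R)
    (tau : 'rV[R]_m -> 'rV[R]_n -> 'rV[R]_m) : Prop := {
  dca_start : forall x, S (w 0%N x) ;
  dca_sample_law : forall k (i : 'I_(N k)), identically_distributed (X i) Z ;
  dca_sample_indep : forall k, independent_rvs (X (k := k)) ;
  dca_past_indep : forall k, independent_systems P (past k) (batch k) ;
  (* The selector is only meaningful on the probability-one event that all
     samples lie in the support; the iterates are unconstrained off it. *)
  dca_step : forall x,
    (forall k (i : 'I_(N k)), measure_support (distribution P Z) (X i x)) ->
    forall k, argmin (fun v => G v - (dot (sample_average tau k x) v)%:E)
                (w k.+1 x)
}.

End stochastic_dc.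

(* Main.v *)
Require Import Defs.
From HB Require Import structures.
From mathcomp Require Import all_boot all_order all_algebra.
From mathcomp Require Import all_classical all_reals all_analysis.
From mathcomp Require Import measurable_realfun.
From mathcomp Require Import ring lra.
Set Implicit Arguments.
Unset Strict Implicit.
Unset Printing Implicit Defensive.
Import Order.TTheory GRing.Theory Num.Theory.
Import numFieldNormedType.Exports.
Local Open Scope classical_set_scope.
Local Open Scope ring_scope.
Local Open Scope ereal_scope.

(** The proof is a descent argument along each sample path. Let taubar w be the
mean of tau w Z, let t_k be the sample average used at step k, and let
e_k = t_k - taubar (w_k) be the sampling error. Taking
expectations in the subgradient inequality of h shows that taubar w is a
subgradient of H at w ([mean_selector_subgradient]), and optimality of w_(k+1)
says that t_k is a subgradient of G at w_(k+1)
([argmin_linear_subdifferential]). Adding the two subgradient inequalities,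
sharpened by the strong convexity of G and of H, and absorbing the error by
Young's inequality gives, with rho = rho_G + rho_H > 0 ([dc_descent]),
  F (w_(k+1)) <= F (w_k) + |e_k|^2 / rho - (rho / 4) |w_(k+1) - w_k|^2.

The samples of step k are independent of each other and of w_k, and tau (v, .)
has mean taubar v. Hence the cross terms in the second moment of e_k vanish by
Fubini's theorem, and the mean of |e_k|^2 is at most C / n_k, where C depends
only on the second moment of tautilde ([sample_error_le]). As sum 1 / n_k is
finite, sum |e_k|^2 is finite almost surely ([dca_error_summable]). On that
event the descent inequality is deterministic: F is bounded on S, so F (w_k)
converges and sum |w_(k+1) - w_k|^2 is finite ([bounded_descent]).

On the same event e_k and w_(k+1) - w_k tend to 0, and taubar (w_k) stays
bounded. So near a limit point v of (w_k) one can also make taubar (w_k)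
converge, to some u; then t_k tends to u and w_(k+1) tends to v. The graphs of
the subdifferentials of the lower semicontinuous functions G and H are closed
([subdifferential_closed]), so u lies in both subdifferentials at v
([cluster_critical_point]).

On the measure-theoretic side, the statement uses Borel sets of a product
space, whereas Fubini's theorem is about the product sigma-algebra; second
countability of Euclidean space reconciles the two ([borel_prod]) and also
shows that a distribution is concentrated on its support
([measure_supportC]). *)

(** * Borel sets of Euclidean space *)

Lemma borel_open {T : ptopologicalType} (U : set T) :
  open U -> measurable (U : set (borel T)).
Proof. by move=> oU; exact: sub_sigma_algebra. Qed.

Lemma borel_closed {T : ptopologicalType} (C : set T) :
  closed C -> measurable (C : set (borel T)).
Proof. by rewrite -openC => /borel_open/measurableC; rewrite setCK. Qed.

Lemma borel_continuous {R : realType} {T : ptopologicalType} (f : T -> R) :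
  continuous f -> measurable_fun [set: borel T] (f : borel T -> R).
Proof.
move=> /continuousP cf; apply: (measurability _ (RGenOpens.measurableE R)).
move=> _ [_ [a [b ->] <-]]; rewrite setTI; apply: borel_open.
exact/cf/interval_open.
Qed.

Lemma borel_lower_semicontinuous {R : realType} {T : ptopologicalType}
    (f : T -> \bar R) :
  lower_semicontinuous f -> measurable_fun [set: borel T] (f : borel T -> \bar R).
Proof.
move=> scif; apply: (measurability _ (ErealGenOInfty.measurableE R)).
move=> /= _ [_ [a ->]] <-; rewrite setTI; apply: borel_open.
by rewrite preimage_itvoy; move/lower_semicontinuousP : scif; exact.
Qed.

(** The base consists of the balls with rational centre and radius the inverse
of a positive integer. *)
Lemma rV_second_countable {R : realType} (n : nat) : @second_countable 'rV[R]_n.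
Proof.
pose b (p : 'rV[rat]_n * nat) : set 'rV[R]_n :=
  ball (map_mx ratr p.1 : 'rV[R]_n) (p.2.+1%:R^-1 : R).
exists (range b).
  exact: sub_countable (card_image_le _ _) (countableP _).
split; first by move=> _ [p _ <-]; exact: ball_open.
move=> x V /nbhs_ballP[_/posnumP[e] xV].
have [k ke] : exists k : nat, (k.+1%:R^-1 < e%:num / 2)%R.
  have [//|k] := @ltr_add_invr R 0%R (e%:num/2) _.
  by rewrite add0r => ?; exists k.
have /choice[q0 q0P] (i : 'I_n) : exists q : rat, (`|x ord0 i - ratr q| < k.+1%:R^-1)%R.
  have [|q] := @rat_in_itvoo R (x ord0 i - k.+1%:R^-1)%R (x ord0 i + k.+1%:R^-1)%R.
    by rewrite ltrBlDr -addrA ltrDl addr_gt0 ?invr_gt0.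
  by rewrite in_itv/= => qx; exists q; rewrite distrC ltr_distl.
pose q : 'rV[rat]_n := (\row_i q0 i)%R.
have xq : ball (map_mx ratr q : 'rV[R]_n) (k.+1%:R^-1 : R) x.
  split; first by [].
  move=> i j; rewrite !mxE/= ord1 /ball/= distrC; exact: q0P.
exists (b (q, k)).
  by split; first by exists (q, k).
move=> y qy; apply: xV; rewrite /= [e%:num]splitr.
have xq' := le_ball (ltW ke) (ball_sym xq).
exact: (ball_triangle xq' (le_ball (ltW ke) qy)).
Qed.

Lemma bigcup_countable_seq {T I : Type} (D : set I) (F : I -> set T) :
  countable D -> D = set0 \/
  exists f : nat -> I, (forall k, D (f k)) /\
    \bigcup_(i in D) F i = \bigcup_k F (f k).
Proof.
move=> /pfcard_geP[->|[f]]; [by left|right].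
have fD k : D (f k) by exact: funS.
exists f; split => //; rewrite eqEsubset; split=> x.
  by move=> [i /(@surj _ _ _ _ f)[k _ <-] Fx]; exists k.
by move=> [k _ Fx]; exists (f k).
Qed.

Lemma measurable_bigcup_countable {d} {T : measurableType d} {I : Type}
    (D : set I) (F : I -> set T) :
  countable D -> (forall i, D i -> measurable (F i)) ->
  measurable (\bigcup_(i in D) F i).
Proof.
move=> /(bigcup_countable_seq F)[->|[f [fD ->]]] mF.
  by rewrite bigcup_set0.
by apply: bigcupT_measurable => k; exact: mF.
Qed.

Lemma measure0_bigcup_countable {d} {T : measurableType d} {R : realType}
    (mu : {measure set T -> \bar R}) {I : Type} (D : set I) (F : I -> set T) :
  countable D -> (forall i, D i -> measurable (F i) /\ mu (F i) = 0) ->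
  mu (\bigcup_(i in D) F i) = 0.
Proof.
move=> cD F0.
apply/(measure_negligible (measurable_bigcup_countable cD (fun i Di => (F0 i Di).1))).
case: (bigcup_countable_seq F cD) => [->|[f [fD ->]]].
  by rewrite bigcup_set0; exact: negligible_set0.
apply: negligible_bigcup => k.
by have [mFk Fk0] := F0 _ (fD k); apply/negligibleP.
Qed.

(** An open set of the product is a countable union of boxes of basic open
sets, so Borel sets of the product belong to the product sigma-algebra. Being
the measurability of the identity, this transfers measurable functions by
composition. *)
Lemma borel_prod {T1 T2 : ptopologicalType} :
  @second_countable T1 -> @second_countable T2 ->
  measurable_fun [set: borel T1 * borel T2] (id : _ -> borel (T1 * T2)%type).
Proof.
move=> [B1 cB1 bB1] [B2 cB2 bB2].
apply: (@measurability _ _ (borel T1 * borel T2)%type (borel (T1 * T2)%type) setT id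
  (@open (T1 * T2)%type)) => //.
move=> _ [U oU <-]; rewrite setTI preimage_id.
pose D := (B1 `*` B2) `&` [set V : set T1 * set T2 | V.1 `*` V.2 `<=` U].
rewrite (_ : U = \bigcup_(V in D) (V.1 `*` V.2)).
  apply: measurable_bigcup_countable.
    apply: sub_countable (subset_card_le (@subIsetl _ _ _)) _.
    exact: countableX.
  move=> V [[B1V B2V] _]; apply: measurableX.
    by apply: borel_open; apply: bB1.1.
  by apply: borel_open; apply: bB2.1.
rewrite eqEsubset; split=> [[x y] Uxy|x [V [_ VU] Vx]]; last exact: VU.
have [[A1 A2] [/= A1x A2y] AU] := open_nbhs_nbhs (conj oU Uxy).
have [V1 [BV1 V1x] VA1] := bB1.2 x A1 A1x.
have [V2 [BV2 V2y] VA2] := bB2.2 y A2 A2y.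
exists (V1, V2) => //; split => //= z [z1 z2]; apply: AU; split.
  exact: VA1.
exact: VA2.
Qed.

Lemma closed_measure_support {R : realType} {n : nat}
    (mu : set (borel 'rV[R]_n) -> \bar R) : closed (measure_support mu).
Proof.
rewrite -openC openE => z /= /existsNP[U /not_implyP[[oU Uz] U0]].
rewrite /interior nbhsE/=; exists U; first by [].
by move=> y Uy /(_ U (conj oU Uy)).
Qed.

(** Each point outside the support has a basic neighbourhood of measure 0, and
there are only countably many basic open sets. *)
Lemma measure_supportC {R : realType} {n : nat}
    (mu : {measure set (borel 'rV[R]_n) -> \bar R}) :
  mu (~` measure_support mu) = 0.
Proof.
have [B cB bB] := @rV_second_countable R n.
pose D := B `&` [set V : set 'rV[R]_n | mu V = 0].
rewrite (_ : ~` _ = \bigcup_(V in D) V).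
  apply: measure0_bigcup_countable.
    exact: sub_countable (subset_card_le (@subIsetl _ _ _)) cB.
  by move=> V [BV V0]; split => //; apply: borel_open; apply: bB.1.
rewrite eqEsubset; split=> [z|z [V [BV V0] Vz] /(_ V)].
  move=> /= /existsNP[U /not_implyP[[oU Uz] U0]].
  have [V [BV Vz] VU] := bB.2 z U (open_nbhs_nbhs (conj oU Uz)).
  exists V => //; split => //=; apply/eqP; rewrite -measure_le0.
  apply: (@le_trans _ _ (mu U)); last by rewrite leNgt; exact/negP.
  by apply: le_measure => //; rewrite inE; apply: borel_open => //; apply: bB.1.
by rewrite V0 ltxx => /(_ (conj (bB.1 V BV) Vz)).
Qed.

(** * Euclidean convexity *)

Section dot_theory.
Context {R : realType} {m : nat}.
Implicit Types u v x y : 'rV[R]_m.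
Local Open Scope ring_scope.

Lemma dotC u v : dot u v = dot v u.
Proof. by apply: eq_bigr => i _; rewrite mulrC. Qed.

Lemma dotDl u v x : dot (u + v) x = dot u x + dot v x.
Proof. by rewrite -big_split; apply: eq_bigr => i _; rewrite mxE mulrDl. Qed.

Lemma dotZl a u x : dot (a *: u) x = a * dot u x.
Proof. by rewrite /dot mulr_sumr; apply: eq_bigr => i _; rewrite mxE mulrA. Qed.

Lemma dotNl u x : dot (- u) x = - dot u x.
Proof. by rewrite -scaleN1r dotZl mulN1r. Qed.

Lemma dotDr u v x : dot x (u + v) = dot x u + dot x v.
Proof. by rewrite !(dotC x) dotDl. Qed.

Lemma dotNr u x : dot x (- u) = - dot x u.
Proof. by rewrite !(dotC x) dotNl. Qed.

Lemma dotZr a u x : dot x (a *: u) = a * dot x u.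
Proof. by rewrite !(dotC x) dotZl. Qed.

Definition dotE := (dotDl, dotDr, dotNl, dotNr, dotZl, dotZr).

Lemma dotuu_ge0 u : 0 <= dot u u.
Proof. by apply: sumr_ge0 => i _; exact: sqr_ge0. Qed.

Lemma enorm_sqr u : enorm u ^+ 2 = dot u u.
Proof. by rewrite sqr_sqrtr ?dotuu_ge0. Qed.

Lemma coord_sqr_le u (c : 'I_m) : u ord0 c ^+ 2 <= dot u u.
Proof.
rewrite /dot (bigD1 c)//= -expr2 lerDl.
by apply: sumr_ge0 => i _; exact: sqr_ge0.
Qed.

Lemma coord_le_enorm u (c : 'I_m) : `|u ord0 c| <= enorm u.
Proof. by rewrite -sqrtr_sqr ler_wsqrtr// coord_sqr_le. Qed.

(** Expand the square of [u - (r / 2) v]. *)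
Lemma dot_young (r : R) u v : 0 < r ->
  dot u v <= r^-1 * dot u u + r / 4 * dot v v.
Proof.
move=> r0; have := dotuu_ge0 (u - (r / 2) *: v).
rewrite !dotE (dotC v u) => uv0; rewrite -(ler_pM2l r0) mulrDr mulVKf ?gt_eqF//.
lra.
Qed.

End dot_theory.

Section rV_convergence.
Context {R : realType} {m : nat} {I : Type} (U : set_system I) {UF : Filter U}.
Implicit Types (x y : I -> 'rV[R]_m) (u v : 'rV[R]_m).

Lemma cvg_coord x v (c : 'I_m) : x i @[i --> U] --> v ->
  x i ord0 c @[i --> U] --> v ord0 c.
Proof.
move=> xv; apply: (cvg_comp _ (fun u : 'rV[R]_m => u ord0 c) xv).
exact: coord_continuous.
Qed.

(** A neighbourhood of a matrix is given by neighbourhoods of its finitely many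
entries. *)
Lemma cvg_rV x v : (forall c, x i ord0 c @[i --> U] --> v ord0 c) ->
  x i @[i --> U] --> v.
Proof.
move=> xv A [B vB BA]; rewrite nbhs_simpl/=.
have : \forall i \near U, forall c, B ord0 c (x i ord0 c).
  by apply: filter_forall => c; apply: xv; exact: vB.
by apply: filterS => i xB; apply: BA => j c; rewrite ord1.
Qed.

Lemma cvg_dot x y v u : x i @[i --> U] --> v ->
  (forall c, y i ord0 c @[i --> U] --> u ord0 c) ->
  dot (x i) (y i) @[i --> U] --> dot v u.
Proof.
move=> xv yu; rewrite /dot.
apply: (@cvg_big R _ +%R _ _ add_continuous _ _ _
  (fun c i => (x i ord0 c * y i ord0 c)%R)).
by move=> c _; apply: cvgM; [exact: cvg_coord|exact: yu].
Qed.

End rV_convergence.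

Section convexity.
Context {R : realType} {m : nat}.
Implicit Types (theta G H : 'rV[R]_m -> \bar R) (w x y v : 'rV[R]_m).

(** Compare, at the point [t x + (1 - t) x0], the subgradient inequality with
the convexity of [theta - mu / 2 |.|^2]. The quadratic terms combine into
[t (1 - t) |x - x0|^2]; divide by [t] and let [t] tend to 0. *)
Lemma strong_subgradient theta (mu : R) x0 y x : (0 <= mu)%R ->
  convex_efun (fun x => theta x - (mu / 2 * enorm x ^+ 2)%:E) ->
  theta x0 \is a fin_num -> theta x \is a fin_num ->
  subdifferential theta x0 y ->
  (fine (theta x0) + dot (x - x0) y + mu / 2 * enorm (x - x0) ^+ 2
     <= fine (theta x))%R.
Proof.
move=> mu0 cvx fx0 fx [_ sub].
have [a ax0] : exists a, theta x0 = a%:E by exists (fine (theta x0)); rewrite fineK.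
have [b bx] : exists b, theta x = b%:E by exists (fine (theta x)); rewrite fineK.
rewrite ax0 bx /= enorm_sqr.
set N := dot (x - x0) (x - x0); have N0 : (0 <= N)%R by exact: dotuu_ge0.
have key (t : R) : (0 < t <= 1)%R ->
    (a + dot (x - x0) y + mu / 2 * (1 - t) * N <= b)%R.
  move=> /andP[t0 t1]; have /cvx : (0 <= t <= 1)%R by rewrite ltW.
  move=> /(_ x x0); rewrite ax0 bx !enorm_sqr.
  have := sub (t *: x + (1 - t) *: x0)%R; rewrite ax0.
  case: (theta _) => [r| |] //=.
  rewrite -!EFinB -!EFinM -!EFinD !lee_fin.
  rewrite /N !dotE (dotC x0 x) => h1 h2.
  rewrite -(ler_pM2l t0).
  move: (dot x y) (dot x0 y) (dot x x) (dot x x0) (dot x0 x0) h1 h2.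
  move=> p q A B C h1 h2.
  have := lerD h1 h2.
  lra.
apply/ler_addgt0Pr => e e0.
pose c := (mu / 2 * N)%R; have c0 : (0 <= c)%R by rewrite mulr_ge0 ?divr_ge0.
have ec : (0 < e + c)%R by rewrite ltr_wpDr.
(* This t makes the defect t c at most e; the denominator is positive even if
   c = 0. *)
have t01 : (0 < e / (e + c) <= 1)%R.
  by rewrite divr_gt0//= ler_pdivrMr// mul1r lerDl.
have := key _ t01.
have : (c * (e / (e + c)) <= e)%R.
  by rewrite mulrA ler_pdivrMr// mulrC ler_wpM2l ?(ltW e0)// lerDr ltW.
by rewrite /c; lra.
Qed.

(** The moduli may be infinite, hence unsuitable as coefficients; smaller
admissible values with a positive sum are enough for the descent. A modulus
other than [-oo] has an admissible value, so it suffices that one modulus be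
positive and the other not [-oo]. *)
Lemma strong_convexity_moduli G H :
  0 < strong_convexity_modulus H + strong_convexity_modulus G ->
  exists muG muH : R, [/\ (0 <= muG)%R, (0 <= muH)%R, (0 < muG + muH)%R,
    convex_efun (fun x => G x - (muG / 2 * enorm x ^+ 2)%:E) &
    convex_efun (fun x => H x - (muH / 2 * enorm x ^+ 2)%:E)].
Proof.
have nonempty theta : strong_convexity_modulus theta != -oo ->
    exists mu : R, (0 <= mu)%R /\
      convex_efun (fun x => theta x - (mu / 2 * enorm x ^+ 2)%:E).
  move=> thN; apply: contrapT => /forallNP noM; move: thN.
  rewrite /strong_convexity_modulus (_ : [set _ | _ in _] = set0).
    by rewrite ereal_sup0.
  by rewrite -subset0 => _ [mu muP <-]; exact: (noM mu).
have positive theta : 0 < strong_convexity_modulus theta ->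
    exists mu : R, (0 < mu)%R /\
      convex_efun (fun x => theta x - (mu / 2 * enorm x ^+ 2)%:E).
  move=> /ereal_sup_gt[_ [mu [mu0 cmu] <-]]; rewrite lte_fin => mu_gt0.
  by exists mu.
move=> rho0.
have HN : strong_convexity_modulus H != -oo.
  by apply: contraTneq rho0 => ->.
have GN : strong_convexity_modulus G != -oo.
  by apply: contraTneq rho0 => ->; rewrite addeNy.
have [H0|H0] := ltP 0 (strong_convexity_modulus H).
  have [muH [muH0 cH]] := positive _ H0.
  have [muG [muG0 cG]] := nonempty _ GN.
  by exists muG, muH; split => //; [exact: ltW|exact: ltr_wpDl].
have G0 : 0 < strong_convexity_modulus G.
  rewrite ltNge; apply: contraTN rho0 => G0.
  by rewrite -leNgt; exact: adde_le0.
have [muH [muH0 cH]] := nonempty _ HN.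
have [muG [muG0 cG]] := positive _ G0.
by exists muG, muH; split => //; [exact: ltW|exact: ltr_wpDr].
Qed.

Lemma argmin_linear_subdifferential G (t : 'rV[R]_m) w :
  G w \is a fin_num -> argmin (fun v => G v - (dot t v)%:E) w ->
  subdifferential G w t.
Proof.
move=> Gw wmin; split; first by rewrite /effective_domain/= ltey_eq Gw.
move=> x; have := wmin x.
rewrite -(fineK Gw); case: (G x) => [b| |] //=; first 1 last.
  by move=> _; rewrite leey.
by rewrite -!EFinB -EFinD !lee_fin !dotE !(dotC t); lra.
Qed.

(** The strong subgradient inequalities of [G] at [w'] and of [H] at [w] add up
to a decrease [(muG + muH) / 2 |w' - w|^2] up to the error [<t - s, w' - w>];
Young's inequality spends half of that decrease on the error. *)
Lemma dc_descent G H (muG muH : R) w w' (t s : 'rV[R]_m) :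
  (0 <= muG)%R -> (0 <= muH)%R -> (0 < muG + muH)%R ->
  convex_efun (fun x => G x - (muG / 2 * enorm x ^+ 2)%:E) ->
  convex_efun (fun x => H x - (muH / 2 * enorm x ^+ 2)%:E) ->
  G w \is a fin_num -> G w' \is a fin_num ->
  H w \is a fin_num -> H w' \is a fin_num ->
  subdifferential G w' t -> subdifferential H w s ->
  (fine (G w') - fine (H w') <= fine (G w) - fine (H w)
     + (muG + muH)^-1 * enorm (t - s) ^+ 2
     - (muG + muH) / 4 * enorm (w' - w) ^+ 2)%R.
Proof.
move=> muG0 muH0 mu0 cG cH Gw Gw' Hw Hw' tG sH.
have := strong_subgradient muG0 cG Gw' Gw tG.
have := strong_subgradient muH0 cH Hw Hw' sH.
have := @dot_young R m (muG + muH)%R (t - s)%R (w' - w)%R mu0.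
rewrite !enorm_sqr.
rewrite [(w - w')%R](_ : _ = - (w' - w))%R ?opprB// [dot (t - s) _]dotC.
set D := (w' - w)%R.
rewrite !dotE; lra.
Qed.

(** Pass to the limit in the subgradient inequality, bounding [theta (x i)] from
below by any [a < theta v]. Convergence of [y] is asked coordinatewise because
this is how the sampling error is controlled. *)
Lemma subdifferential_closed theta {I : Type} (U : set_system I)
    {UF : ProperFilter U} (x y : I -> 'rV[R]_m) v (u : 'rV[R]_m) :
  lower_semicontinuous theta -> effective_domain theta v ->
  x i @[i --> U] --> v -> (forall c, y i ord0 c @[i --> U] --> u ord0 c) ->
  (\forall i \near U, subdifferential theta (x i) (y i)) ->
  subdifferential theta v u.
Proof.
move=> lsc dv xv yu sub; split => // z.
have [|] := eqVneq (theta z) +oo; first by move=> ->; rewrite leey.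
move=> zy.
case thv : (theta v) => [r| |]; [|by rewrite /effective_domain/= thv in dv|];
  last by rewrite addNye leNye.
have below (a : R) : (a < r)%R -> (a + dot (z - v) u)%:E <= theta z.
  move=> ar.
  have axv : \forall i \near U, a%:E < theta (x i).
    have /lsc[V vV aV] : a%:E < theta v by rewrite thv lte_fin.
    by have := xv _ vV; rewrite nbhs_simpl/=; apply: filterS => i; exact: aV.
  have nz : \forall i \near U, (a + dot (z - x i) (y i))%:E <= theta z.
    near=> i; rewrite EFinD.
    apply: (@le_trans _ _ (theta (x i) + (dot (z - x i) (y i))%:E)).
      by rewrite leeD2r// ltW//; near: i.
    by have [_] : subdifferential theta (x i) (y i) by near: i.
  have cv : (a + dot (z - x i) (y i))%R @[i --> U] --> (a + dot (z - v) u)%R.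
    by apply: cvgD; [exact: cvg_cst|apply: cvg_dot => //; apply: cvgB => //; exact: cvg_cst].
  move: zy nz; case: (theta z) => [b| |] // _ nz.
    by rewrite lee_fin; apply: cvgr_to_le cv _; apply: filterS nz => i; rewrite lee_fin.
  by have [i] := filter_ex nz; rewrite leeNy_eq.
have /below : (r - 1 < r)%R by lra.
case: (theta z) zy below => [b| |] // _ below _.
rewrite -EFinD lee_fin; apply/ler_addgt0Pr => e e0.
have /below : (r - e < r)%R by lra.
by rewrite lee_fin; lra.
Unshelve. all: by end_near. Qed.

End convexity.

(** * Descent along bounded sequences *)

(** The sequence [a] minus the partial sums of [b] is nonincreasing and bounded
below, so it converges, and so does [a]; telescoping the inequality bounds the
partial sums of [c]. *)
Lemma bounded_descent {R : realType} (a b c : nat -> R) (M : R) :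
  (forall k, `|a k| <= M)%R -> (forall k, 0 <= b k)%R -> (forall k, 0 <= c k)%R ->
  (forall k, a k.+1 <= a k + b k - c k)%R ->
  \sum_(1 <= k <oo) (b k)%:E < +oo ->
  cvgn a /\ \sum_(1 <= k <oo) (c k)%:E < +oo.
Proof.
move=> aM b0 c0 step bfin.
(* Indices are shifted by 1 because the sums start at 1. *)
pose B := fun n => (\sum_(1 <= k < n.+1) b k)%R.
pose s := fun n => (a n.+1 - B n)%R.
pose L := fine (\sum_(1 <= k <oo) (b k)%:E).
have bE : \sum_(1 <= k <oo) (b k)%:E = L%:E.
  rewrite fineK// ge0_fin_numE//.
  by apply: nneseries_ge0 => k _ _; rewrite lee_fin.
have BL n : (B n <= L)%R.
  rewrite -lee_fin -bE /B -sumEFin.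
  by apply: nneseries_lim_ge => k _ _; rewrite lee_fin.
have BS n : (B n.+1 = B n + b n.+1)%R by rewrite /B big_nat_recr.
have aM1 n : (- M <= a n <= M)%R by rewrite -ler_norml.
have cB : cvgn B.
  apply: nondecreasing_is_cvgn; last by exists L => _ [n _ <-].
  by apply/nondecreasing_seqP => n; rewrite BS lerDl.
have cs : cvgn s.
  apply: nonincreasing_is_cvgn.
    apply/nonincreasing_seqP => n; rewrite /s BS.
    by have := step n.+1; have := c0 n.+1; lra.
  exists (- M - L)%R => _ [n _ <-]; rewrite /s.
  by have := BL n; have := aM1 n.+1; lra.
split.
  have : cvgn (s \+ B)%R by exact: is_cvgD.
  rewrite (_ : (s \+ B)%R = fun n => a (n + 1)%N); last first.
    by apply/funext => n; rewrite /s/= subrK addn1.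
  by move=> /cvg_ex[l al]; apply/cvg_ex; exists l; rewrite -(cvg_shiftn 1).
have cbound n : (\sum_(1 <= k < n.+1) c k <= a 1%N - a n.+1 + B n)%R.
  elim: n => [|n ih]; first by rewrite /B !big_geq// subrr addr0.
  by rewrite big_nat_recr//= BS; have := step n.+1; lra.
apply: (@le_lt_trans _ _ (2 * M + L)%:E); last exact: ltry.
apply: lime_le.
  by apply: is_cvg_nneseries => k _ _; rewrite lee_fin.
exists 1%N => // -[//|n] _ /=; rewrite sumEFin lee_fin.
by have := cbound n; have := BL n; have := aM1 1%N; have := aM1 n.+1; lra.
Qed.

Lemma summableZ {R : realType} (r : R) (a b : nat -> R) :
  (0 <= r)%R -> (forall k, 0 <= a k)%R -> (forall k, b k = r * a k)%R ->
  \sum_(1 <= k <oo) (a k)%:E < +oo -> \sum_(1 <= k <oo) (b k)%:E < +oo.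
Proof.
move=> r0 a0 ba afin.
under eq_eseriesr do rewrite ba EFinM.
rewrite nneseriesZl//; last by move=> k _; rewrite lee_fin.
by rewrite lte_mul_pinfty// lee_fin.
Qed.

Lemma summable_coord_cvg0 {R : realType} (a u : nat -> R) :
  (forall k, u k ^+ 2 <= a k)%R -> \sum_(1 <= k <oo) (a k)%:E < +oo ->
  u k @[k --> \oo] --> (0%R : R).
Proof.
move=> ua afin.
have a0 k : (0 <= a k)%R by exact: le_trans (sqr_ge0 _) (ua k).
have acvg : a (k + 1)%N @[k --> \oo] --> (0%R : R).
  apply: (@cvg_series_cvg_0 R R).
  pose L := fine (\sum_(1 <= k <oo) (a k)%:E).
  apply: nondecreasing_is_cvgn.
    by apply/nondecreasing_seqP => n; rewrite /series/= big_nat_recr//= lerDl.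
  exists L => _ [n _ <-]; rewrite -lee_fin /series/= -sumEFin /L fineK; last first.
    by rewrite ge0_fin_numE//; apply: nneseries_ge0 => k _ _; rewrite lee_fin.
  rewrite -(nneseries_addn 1 (f := fun k => (a k)%:E)).
    by apply: nneseries_lim_ge => k _ _; rewrite lee_fin.
  by move=> k; rewrite lee_fin.
have {}acvg : a k @[k --> \oo] --> (0%R : R) by rewrite -(cvg_shiftn 1).
apply/cvgr0Pnorm_lt => e e0.
have e2 : (0 < e ^+ 2)%R by rewrite exprn_gt0.
move/cvgr0Pnorm_lt : acvg => /(_ _ e2); apply: filterS => k.
rewrite ger0_norm// => ae; rewrite -(@ltr_pXn2r _ 2) ?nnegrE ?(ltW e0)//.
by rewrite real_normK ?num_real// (le_lt_trans (ua k)).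
Qed.

(** * Second moment of the sampling error *)

Section pair_rv.
Context {d d1 d2} {Omega : measurableType d} {T1 : measurableType d1}
  {T2 : measurableType d2} {R : realType} (P : probability Omega R).

Definition pair_rv (X1 : {RV P >-> T1}) (X2 : {RV P >-> T2}) (x : Omega) :
  T1 * T2 := (X1 x, X2 x).

HB.instance Definition _ (X1 : {RV P >-> T1}) (X2 : {RV P >-> T2}) :=
  isMeasurableFun.Build _ _ _ _ (pair_rv X1 X2)
    (measurable_fun_pair (measurable_funPT X1) (measurable_funPT X2)).

(** A measure on a product is determined by its values on rectangles. *)
Lemma pair_rv_law (X1 : {RV P >-> T1}) (X2 : {RV P >-> T2})
    (m1 : probability T1 R) (m2 : probability T2 R) :
  (forall A B, measurable A -> measurable B ->
    P (X1 @^-1` A `&` X2 @^-1` B) = m1 A * m2 B) ->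
  forall C, measurable C -> distribution P (pair_rv X1 X2) C = (m1 \x m2) C.
Proof.
move=> law C mC; apply/esym.
apply: (product_measure_unique (m' := distribution P (pair_rv X1 X2))) => //.
Qed.

End pair_rv.

Section mean_square.
Context {d d1 d2} {Omega : measurableType d} {T1 : measurableType d1}
  {T2 : measurableType d2} {R : realType}.
Variables (P : probability Omega R) (mu : probability T2 R).
Variables (Y : {RV P >-> T1}) (phi : T1 * T2 -> R).
Hypothesis mphi : measurable_fun [set: T1 * T2] phi.
Hypothesis phi_int :
  forall y, mu.-integrable [set: T2] (fun z => (phi (y, z))%:E).
Hypothesis phi_mean0 : forall y, \int[mu]_z (phi (y, z))%:E = 0.

Let mphiT (X : {RV P >-> T2}) :
  measurable_fun [set: Omega] (fun x => phi (Y x, X x)).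
Proof. exact: (measurableT_comp mphi (measurable_funPT (pair_rv Y X))). Qed.

Lemma integrable_cross (X1 X2 : {RV P >-> T2}) :
  P.-integrable [set: Omega] (fun x => (phi (Y x, X1 x) ^+ 2)%:E) ->
  P.-integrable [set: Omega] (fun x => (phi (Y x, X2 x) ^+ 2)%:E) ->
  P.-integrable [set: Omega] (fun x => (phi (Y x, X1 x) * phi (Y x, X2 x))%:E).
Proof.
move=> i1 i2; apply: le_integrable (integrableD _ i1 i2) => //.
  by apply/measurable_EFinP; apply: measurable_funM; exact: mphiT.
move=> x _; rewrite -EFinD !abse_EFin lee_fin.
rewrite [leRHS]ger0_norm ?addr_ge0 ?sqr_ge0//.
move: (phi _) (phi _) => a b; rewrite ler_norml.
by have := sqr_ge0 (a + b); have := sqr_ge0 (a - b); nra.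
Qed.

(** Under the law of [(Y, (X1, X2))], which is a product by independence,
integrate first over [X2] with [Y] and [X1] fixed: [phi] has mean 0. The inner
pair is integrated against its joint law [nu], itself equal to [mu \x mu]. *)
Lemma integral_cross0 (X1 X2 : {RV P >-> T2}) :
  (forall A B, measurable A -> measurable B ->
    P (X1 @^-1` A `&` X2 @^-1` B) = mu A * mu B) ->
  (forall A E, measurable A -> measurable E ->
    P (Y @^-1` A `&` pair_rv X1 X2 @^-1` E) =
    P (Y @^-1` A) * P (pair_rv X1 X2 @^-1` E)) ->
  P.-integrable [set: Omega] (fun x => (phi (Y x, X1 x) ^+ 2)%:E) ->
  P.-integrable [set: Omega] (fun x => (phi (Y x, X2 x) ^+ 2)%:E) ->
  \int[P]_x (phi (Y x, X1 x) * phi (Y x, X2 x))%:E = 0.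
Proof.
move=> indX indY i1 i2.
pose nu := distribution P (pair_rv X1 X2).
pose Psi (p : T1 * (T2 * T2)) : \bar R :=
  (phi (p.1, p.2.1) * phi (p.1, p.2.2))%:E.
have mPsi : measurable_fun [set: T1 * (T2 * T2)] Psi.
  apply/measurable_EFinP; apply: measurable_funM.
    apply: (measurableT_comp mphi); apply: measurable_fun_pair => //.
    by apply: (measurableT_comp measurable_fst); exact: measurable_snd.
  apply: (measurableT_comp mphi); apply: measurable_fun_pair => //.
  by apply: (measurableT_comp measurable_snd); exact: measurable_snd.
pose W := pair_rv Y (pair_rv X1 X2).
have iPsi : P.-integrable [set: Omega] (Psi \o W) by exact: integrable_cross.
have lawW C : measurable C -> distribution P W C = (distribution P Y \x nu) C.
  by apply: pair_rv_law => A E mA mE; exact: indY.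
rewrite -[LHS]/(\int[P]_x (Psi \o W) x) -integral_distribution//.
rewrite (eq_measure_integral (distribution P Y \x nu)); last first.
  by move=> C mC _; exact: lawW.
have iPsi2 : (distribution P Y \x nu).-integrable setT Psi.
  have := integrable_pushforward (measurable_funPT W) mPsi iPsi measurableT.
  move=> /integrableP[_ fPsi]; apply/integrableP; split => //.
  rewrite (eq_measure_integral (distribution P W))//.
  by move=> C mC _; apply/esym; exact: lawW.
rewrite -integral12_prod_meas1//.
rewrite -[RHS](integral0 (distribution P Y) setT).
apply: ae_eq_integral => //.
  exact: (measurable_fubini_F iPsi2).
have := ae_integrable1 iPsi2; apply: filterS => y iy _.
rewrite /fubini_F (eq_measure_integral (mu \x mu)); last first.
  by move=> C mC _; apply: pair_rv_law.
have iy2 : (mu \x mu).-integrable setT (fun z => Psi (y, z)).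
  move: iy => /integrableP[my fy]; apply/integrableP; split => //.
  rewrite (eq_measure_integral nu)//.
  by move=> C mC _; apply/esym; apply: pair_rv_law.
rewrite -integral12_prod_meas1// /fubini_F.
rewrite -[RHS](integral0 mu setT); apply: eq_integral => a _ /=.
under eq_integral do rewrite /Psi/= EFinM.
by rewrite integralZl// phi_mean0 mule0.
Qed.

(** Expanding the square leaves the [N] diagonal terms, each at most [C], since
the cross terms vanish. *)
Lemma mean_square_average_le (N : nat) (X : 'I_N -> {RV P >-> T2}) (C : R) :
  (0 < N)%N ->
  (forall i j, i != j -> forall A B, measurable A -> measurable B ->
    P (X i @^-1` A `&` X j @^-1` B) = mu A * mu B) ->
  (forall i j A E, measurable A -> measurable E ->
    P (Y @^-1` A `&` pair_rv (X i) (X j) @^-1` E) =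
    P (Y @^-1` A) * P (pair_rv (X i) (X j) @^-1` E)) ->
  (forall i, P.-integrable [set: Omega] (fun x => (phi (Y x, X i x) ^+ 2)%:E)) ->
  (forall i, \int[P]_x (phi (Y x, X i x) ^+ 2)%:E <= C%:E) ->
  \int[P]_x ((N%:R^-1 * \sum_(i < N) phi (Y x, X i x)) ^+ 2)%:E
    <= (C * N%:R^-1)%:E.
Proof.
move=> N0 indX indY sq_int sq_le.
have cross_int i j := integrable_cross (sq_int i) (sq_int j).
under eq_integral => x _.
  rewrite exprMn [X in (_ * X)%R]expr2 big_distrlr/= EFinM -sumEFin.
  under eq_bigr do rewrite -sumEFin.
  over.
rewrite integralZl//=; last first.
  by apply: integrable_sum => // i _; apply: integrable_sum => // j _.
rewrite integral_sum//; last by move=> i; apply: integrable_sum => // j _.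
have -> : (C * N%:R^-1)%:E = (N%:R^-1 ^+ 2)%:E * \sum_(i < N) C%:E.
  rewrite sumEFin sumr_const card_ord -EFinM; congr EFin.
  by rewrite -mulr_natr; field; rewrite pnatr_eq0 -lt0n.
rewrite lee_pmul2l ?lte_fin ?exprn_gt0 ?invr_gt0 ?ltr0n//.
apply: lee_sum => i _.
rewrite integral_sum// (bigD1 i)//= big1 ?adde0 => [|j ji].
  exact: sq_le.
apply: integral_cross0 (sq_int i) (sq_int j); last exact: indY.
by apply: indX; rewrite eq_sym.
Qed.

End mean_square.

(** The measurability part of Fubini's theorem for functions that need not be
integrable on the product: integrate the positive and negative parts. *)
Lemma measurable_partial_integral {d1 d2} {T1 : measurableType d1}
    {T2 : measurableType d2} {R : realType} (mu : probability T2 R)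
    (f : T1 * T2 -> \bar R) :
  measurable_fun [set: T1 * T2] f ->
  measurable_fun [set: T1] (fun y => \int[mu]_z f (y, z)).
Proof.
move=> mf.
rewrite (_ : (fun _ => _) =
    (fun y => fubini_F mu f^\+ y - fubini_F mu f^\- y)); last first.
  apply/funext => y; rewrite [LHS]integralE; congr (_ - _).
    by under eq_integral do rewrite funepos_comp/=.
  by under eq_integral do rewrite funeneg_comp/=.
apply: emeasurable_funB; apply: measurable_fun_fubini_tonelli_F => //.
  exact: measurable_funepos.
exact: measurable_funeneg.
Qed.

Section sample_error.
Context {d1 d2} {T1 : measurableType d1} {T2 : measurableType d2} {R : realType}.
Variables (mu : probability T2 R) (f : T1 * T2 -> R) (b : T2 -> R).
Hypothesis mf : measurable_fun [set: T1 * T2] f.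
Hypothesis fb : forall y z, (`|f (y, z)| <= `|b z|)%R.
Hypothesis b2_int : mu.-integrable [set: T2] (fun z => (b z ^+ 2)%:E).

Definition partial_mean (y : T1) : R := fine (\int[mu]_z (f (y, z))%:E).

Let A : R := fine (\int[mu]_z (b z ^+ 2)%:E).

Let integral_prob_cst r : \int[mu]_z r%:E = r%:E.
Proof.
rewrite integral_cst// [X in _ * X](_ : _ = 1) ?mule1//.
exact: probability_setT.
Qed.

Let AE : \int[mu]_z (b z ^+ 2)%:E = A%:E.
Proof. by rewrite fineK//; exact: integrable_fin_num. Qed.

Let b1_int : mu.-integrable [set: T2] (fun z => (1 + b z ^+ 2)%:E).
Proof.
under eq_fun do rewrite EFinD.
apply: integrableD => //.
exact: (finite_measure_integrable_cst mu 1).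
Qed.

Let mfy y : measurable_fun [set: T2] (fun z => f (y, z)).
Proof. exact: (measurableT_comp mf (measurable_pair1 _)). Qed.

Let norm_le1 y z : (`|f (y, z)| <= 1 + b z ^+ 2)%R.
Proof.
apply: (le_trans (fb y z)); rewrite -[X in (1 + X)%R]real_normK ?num_real//.
by have := normr_ge0 (b z); move: (`|b z|)%R => t t0; nra.
Qed.

Lemma section_integrable y : mu.-integrable [set: T2] (fun z => (f (y, z))%:E).
Proof.
apply: le_integrable b1_int => //; first exact/measurable_EFinP.
move=> z _; rewrite !abse_EFin lee_fin (le_trans (norm_le1 y z))//.
exact: ler_norm.
Qed.

Lemma partial_meanE y : \int[mu]_z (f (y, z))%:E = (partial_mean y)%:E.
Proof. by rewrite fineK//; exact: integrable_fin_num (section_integrable y). Qed.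

Lemma measurable_partial_mean : measurable_fun [set: T1] partial_mean.
Proof.
apply: (measurableT_comp (fine_measurable _)) => //.
by apply: (@measurable_partial_integral _ _ _ _ _ mu (EFin \o f)); exact/measurable_EFinP.
Qed.

(** Only the second moment of [b] is at hand, whence the bound of [|b|] by
[1 + b ^+ 2]. *)
Lemma partial_mean_bound y : (`|partial_mean y| <= 1 + A)%R.
Proof.
rewrite -lee_fin -abse_EFin -partial_meanE.
apply: (le_trans (le_abse_integral _ _ _)) => //; first exact/measurable_EFinP.
rewrite [leRHS](_ : _ = \int[mu]_z (1 + b z ^+ 2)%:E).
  apply: ge0_le_integral => //.
  - by do 2 apply: measurableT_comp => //.
  - by case/integrableP : b1_int.
  - by move=> z _; rewrite abse_EFin lee_fin.
under eq_integral do rewrite EFinD.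
rewrite integralD//; last exact: (finite_measure_integrable_cst mu 1).
by rewrite integral_prob_cst AE.
Qed.

(** The bound [mean_square_average_le] applied to the centred function
[f - partial_mean f]. The constant is chosen before the probability space, the
conditioning variable and the sample size, so that it serves all steps of the
algorithm. *)
Lemma sample_error_le : exists C : R,
  forall {d} {Omega : measurableType d} (P : probability Omega R)
    (Y : {RV P >-> T1}) (N : nat) (X : 'I_N -> {RV P >-> T2}),
  (0 < N)%N ->
  (forall i B, measurable B -> distribution P (X i) B = mu B) ->
  (forall i j, i != j -> forall B B', measurable B -> measurable B' ->
    P (X i @^-1` B `&` X j @^-1` B') = P (X i @^-1` B) * P (X j @^-1` B')) ->
  (forall i j B E, measurable B -> measurable E ->
    P (Y @^-1` B `&` pair_rv (X i) (X j) @^-1` E) =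
    P (Y @^-1` B) * P (pair_rv (X i) (X j) @^-1` E)) ->
  \int[P]_x ((N%:R^-1 * \sum_(i < N) f (Y x, X i x)
              - partial_mean (Y x)) ^+ 2)%:E <= (C * N%:R^-1)%:E.
Proof.
(* From (p - q)^2 <= 2 p^2 + 2 q^2, |f| <= |b| and |partial_mean| <= 1 + A. *)
exists (2 * A + 2 * (1 + A) ^+ 2)%R => d Omega P Y N X N0 lawX indX indY.
pose phi p := (f p - partial_mean p.1)%R.
have mphi : measurable_fun [set: T1 * T2] phi.
  apply: measurable_funB => //.
  exact: (measurableT_comp measurable_partial_mean measurable_fst).
have mean_int y : mu.-integrable [set: T2] (fun=> (partial_mean y)%:E).
  exact: (finite_measure_integrable_cst mu (partial_mean y)).
have phi_int y : mu.-integrable [set: T2] (fun z => (phi (y, z))%:E).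
  under eq_fun do rewrite EFinB.
  exact: (integrableB _ (section_integrable y) (mean_int y)).
have phi_mean0 y : \int[mu]_z (phi (y, z))%:E = 0.
  under eq_integral do rewrite EFinB.
  rewrite (integralB_EFin measurableT (section_integrable y) (mean_int y)).
  by rewrite integral_prob_cst partial_meanE subee.
have phi2 y z : (phi (y, z) ^+ 2 <= 2 * b z ^+ 2 + 2 * (1 + A) ^+ 2)%R.
  have h1 : (f (y, z) ^+ 2 <= b z ^+ 2)%R.
    by rewrite -[leLHS]real_normK ?num_real// -[leRHS]real_normK ?num_real// lerXn2r ?nnegrE.
  have h2 : (partial_mean y ^+ 2 <= (1 + A) ^+ 2)%R.
    rewrite -[leLHS]real_normK ?num_real// lerXn2r ?nnegrE ?partial_mean_bound//.
    exact: le_trans (partial_mean_bound y).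
  rewrite /phi/=; move: (f _) (partial_mean y) h1 h2 => p q h1 h2.
  by have := sqr_ge0 (p + q); nra.
pose bnd z := (2 * b z ^+ 2 + 2 * (1 + A) ^+ 2)%R.
have cst_int : mu.-integrable [set: T2] (fun=> (2 * (1 + A) ^+ 2)%:E).
  exact: (finite_measure_integrable_cst mu _).
have bnd_int : mu.-integrable [set: T2] (fun z => (bnd z)%:E).
  rewrite /bnd; under eq_fun do rewrite EFinD EFinM.
  by apply: integrableD => //; exact: integrableZl.
have bndE : \int[mu]_z (bnd z)%:E = (2 * A + 2 * (1 + A) ^+ 2)%:E.
  rewrite /bnd; under eq_integral do rewrite EFinD EFinM.
  rewrite integralD//; last exact: integrableZl.
  by rewrite integralZl// AE integral_prob_cst.
have mbnd : measurable_fun [set: T2] bnd.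
  by apply/measurable_EFinP; case/integrableP : bnd_int.
have bnd_ge0 z : (0 <= bnd z)%R by rewrite addr_ge0// mulr_ge0// sqr_ge0.
have lawE i : \int[P]_x (bnd (X i x))%:E = (2 * A + 2 * (1 + A) ^+ 2)%:E.
  rewrite -bndE -[LHS](@ge0_integral_distribution _ _ _ _ _ P (X i) (EFin \o bnd)).
  - by apply: eq_measure_integral => B mB _; exact: lawX.
  - exact/measurable_EFinP.
  - by move=> z; rewrite lee_fin.
have mphi2 i : measurable_fun [set: Omega] (fun x => (phi (Y x, X i x) ^+ 2)%:E).
  apply/measurable_EFinP; apply: measurable_funX.
  exact: (measurableT_comp mphi (measurable_funPT (pair_rv Y (X i)))).
have mbndX i : measurable_fun [set: Omega] (fun x => (bnd (X i x))%:E).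
  by apply/measurable_EFinP; apply: (measurableT_comp mbnd).
have phi2_le i : \int[P]_x (phi (Y x, X i x) ^+ 2)%:E
    <= (2 * A + 2 * (1 + A) ^+ 2)%:E.
  rewrite -(lawE i); apply: ge0_le_integral => //.
  - by move=> x _; rewrite lee_fin sqr_ge0.
  - by move=> x _; rewrite lee_fin.
have := @mean_square_average_le _ _ _ _ _ _ _ P mu Y phi mphi phi_int phi_mean0
  N X _ N0 _ indY _ phi2_le.
have avgE x : (N%:R^-1 * \sum_(i < N) f (Y x, X i x) - partial_mean (Y x)
    = N%:R^-1 * \sum_(i < N) phi (Y x, X i x))%R.
  rewrite /phi/= sumrB sumr_const card_ord mulrBr -[(partial_mean _ *+ N)%R]mulr_natl.
  by rewrite mulKf// pnatr_eq0 -lt0n.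
under [X in _ -> X <= _]eq_integral do rewrite avgE.
apply.
- by move=> i j ij B B' mB mB'; rewrite indX// -(lawX i)// -(lawX j).
- move=> i; apply/integrableP; split => //.
  under eq_integral do rewrite gee0_abs ?lee_fin ?sqr_ge0//.
  by rewrite (le_lt_trans (phi2_le i))// ltry.
Qed.

End sample_error.

(** * Almost sure events *)

(** By monotone convergence the sum of the series has a finite mean. *)
Lemma ae_summable {d} {Omega : measurableType d} {R : realType}
    (P : probability Omega R) (e : nat -> Omega -> R) (u : nat -> R) (C : R) :
  (forall k, measurable_fun [set: Omega] (e k)) -> (forall k x, 0 <= e k x)%R ->
  (0 <= C)%R -> (forall k, 0 <= u k)%R ->
  (forall k, \int[P]_x (e k x)%:E <= (C * u k)%:E) ->
  \sum_(1 <= k <oo) (u k)%:E < +oo ->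
  {ae P, forall x, \sum_(1 <= k <oo) (e k x)%:E < +oo}.
Proof.
move=> me e0 C0 u0 eu ufin.
pose s x := \sum_(0 <= k <oo) (e (k + 1)%N x)%:E.
have sE x : s x = \sum_(1 <= k <oo) (e k x)%:E.
  by rewrite -(nneseries_addn 1)// => k; rewrite lee_fin.
have ms : measurable_fun [set: Omega] s.
  apply: (ge0_emeasurable_sum (P := xpredT)) => [k x _ _|k _].
    by rewrite lee_fin.
  exact/measurable_EFinP.
have s0 x : 0 <= s x by apply: nneseries_ge0 => k _ _; rewrite lee_fin.
have s_int : P.-integrable [set: Omega] s.
  apply/integrableP; split => //.
  under eq_integral do rewrite gee0_abs//.
  rewrite integral_nneseries//; last 2 first.
    by move=> k; exact/measurable_EFinP.
    by move=> k x _; rewrite lee_fin.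
  rewrite (nneseries_addn (f := fun k => \int[P]_x (e k x)%:E)); last first.
    by move=> k; apply: integral_ge0 => x _; rewrite lee_fin.
  apply: (@le_lt_trans _ _ (\sum_(1 <= k <oo) C%:E * (u k)%:E)).
    by apply: lee_nneseries => k _ *; [apply: integral_ge0 => x _; rewrite lee_fin|rewrite -EFinM].
  rewrite nneseriesZl//; last by move=> k _; rewrite lee_fin.
  by rewrite lte_mul_pinfty// ?lee_fin//.
have := integrable_ae measurableT s_int; apply: filterS => x /(_ I).
by rewrite -sE ge0_fin_numE.
Qed.

Lemma ae_probability1 {d} {T : measurableType d} {R : realType}
    (P : probability T R) (Q : T -> Prop) :
  {ae P, forall x, Q x} ->
  exists L : set T, [/\ measurable L, P L = 1 & forall x, L x -> Q x].
Proof.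
move=> [A [mA PA0 QA]]; exists (~` A); split.
- exact: measurableC.
- by rewrite probability_setC// PA0 sube0.
- by move=> x Ax; apply: contrapT => nQ; apply: Ax; exact: QA.
Qed.

(** The upper limit of the sequence is measurable everywhere; truncating it at
[`|M|] makes it integrable and changes nothing on the almost sure event. *)
Lemma ae_limit_rv {d} {T : measurableType d} {R : realType}
    (P : probability T R) (a : nat -> T -> R) (M : R) :
  (forall k, measurable_fun [set: T] (a k)) ->
  {ae P, forall x, (forall k, `|a k x| <= M)%R /\ cvgn (a ^~ x)} ->
  exists f : {RV P >-> R}, P.-integrable [set: T] (EFin \o f) /\
    {ae P, forall x, a k x @[k --> \oo] --> f x}.
Proof.
move=> ma aM.
pose g x := Order.max (- `|M|)%R (Order.min `|M|%R (fine (limn_esup (fun k => (a k x)%:E)))).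
have mg : measurable_fun [set: T] g.
  apply: measurable_maxr => //; apply: measurable_minr => //.
  apply: (measurableT_comp (fine_measurable _)) => //.
  by apply: measurable_fun_limn_esup => k; exact/measurable_EFinP.
have gM x : (`|g x| <= `|M|)%R.
  rewrite /g ler_norml le_max lexx/= ge_max ge_min lexx/=.
  by rewrite (le_trans _ (normr_ge0 M))// oppr_le0.
exists (mfun_Sub (mem_set mg)); split.
  apply: measurable_bounded_integrable => //.
    by rewrite [ltLHS](_ : _ = 1) ?ltry//; exact: probability_setT.
  by exists `|M|%R; split => [|y yM x _]; [exact: num_real|exact: le_trans (gM x) (ltW yM)].
apply: filterS aM => x [aM /cvg_ex[l al]].
suff -> : mfun_Sub (mem_set mg) x = l by [].
rewrite mfun_valP /g is_cvg_limn_esupE; last first.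
  by apply/cvg_ex; exists l%:E; apply/fine_cvgP; split => //; exact: nearW.
have -> : limn (fun k => (a k x)%:E) = l%:E.
  by apply/cvg_lim => //; apply/fine_cvgP; split => //; exact: nearW.
have lM : (`|l| <= M)%R.
  by apply: (cvgr_to_le (cvg_norm al)); exact: nearW.
have := le_trans lM (ler_norm M); rewrite ler_norml => /andP[lM1 lM2] /=.
by rewrite min_r// max_r.
Qed.

(** * Limit points *)

(** The trace of the filter on the preimages of the neighbourhoods of [v]. It
plays the role of a subsequence, and refining it again handles a second
sequence. *)
Lemma cluster_refine {I : Type} {T : topologicalType} (F : set_system I)
    {FF : ProperFilter F} (x : I -> T) (v : T) :
  cluster (x i @[i --> F]) v ->
  exists U : set_system I, [/\ ProperFilter U, F `<=` U & x i @[i --> U] --> v].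
Proof.
move=> clv.
exists [set A | exists2 B, nbhs v B & F [set i | B (x i) -> A i]]; split.
- apply: Build_ProperFilter_ex.
    move=> A [B vB FB]; apply: contrapT => /forallNP noA.
    have FnB : F (x @^-1` (~` B)).
      by apply: filterS FB => i BA Bi; exact: noA (BA Bi).
    have [y [nBy By]] := clv _ _ FnB vB; exact: (nBy By).
  split.
  + by exists setT; [exact: filterT|exact: filterE].
  + move=> A A' [B vB FB] [B' vB' FB']; exists (B `&` B'); first exact: filterI.
    by apply: filterS2 FB FB' => i BA BA' [/BA ? /BA'].
  + move=> A A' AA' [B vB FB]; exists B => //.
    by apply: filterS FB => i BA Bi; exact/AA'/BA.
- move=> A FA; exists setT; first exact: filterT.
  by apply: filterS FA => i Ai _.
- by move=> B vB; exists B => //; apply: (@filterE _ F) => i.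
Qed.

(** Refine the filter at infinity twice: first so that [x] tends to the limit
point [v], then so that the bounded [s] tends to some [u]. Then [t] tends to
[u], the shifted sequence [x k.+1] tends to [v], and [u] belongs to both
subdifferentials by closedness. *)
Lemma cluster_critical_point {R : realType} {m : nat} (S : set 'rV[R]_m)
    (G H : 'rV[R]_m -> \bar R) (x s t : nat -> 'rV[R]_m) (B : R) v :
  closed S -> lower_semicontinuous G -> lower_semicontinuous H ->
  S `<=` effective_domain G -> S `<=` effective_domain H ->
  (forall k, S (x k)) ->
  (forall k, subdifferential G (x k.+1) (t k)) ->
  (forall k, subdifferential H (x k) (s k)) ->
  (forall k c, `|s k ord0 c| <= B)%R ->
  (forall c, (t k - s k)%R ord0 c @[k --> \oo] --> (0%R : R)) ->
  (forall c, (x k.+1 - x k)%R ord0 c @[k --> \oo] --> (0%R : R)) ->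
  cluster (x k @[k --> \oo]) v ->
  critical_point G H v.
Proof.
move=> Scl Glsc Hlsc SG SH Sx Gt Hs sB ts0 xx0 clv.
have [U [UF ooU xv]] := cluster_refine clv.
pose K : set R := `[(- B)%R, B]%classic.
have cptK : compact [set u : 'rV[R]_m | forall c, K (u ord0 c)].
  by apply: (@rV_compact R m (fun=> K)) => i; exact: segment_compact.
have [|u [Ku /cluster_refine[V [VF UV su]]]] := cptK (s k @[k --> U]) _.
  by apply: (@filterE _ U) => k c; rewrite /K/= in_itv/= -ler_norml.
have ooV : \oo `<=` V by move=> A /ooU/UV.
have toV (a : nat -> R) l : a k @[k --> \oo] --> l -> a k @[k --> V] --> l.
  by move=> al A /al; exact: ooV.
have {}xv : x k @[k --> V] --> v by move=> A /xv; exact: UV.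
have Sv : S v by apply: (closed_cvg _ Scl _ _ xv); exact: filterE.
have su' c : s k ord0 c @[k --> V] --> u ord0 c by exact: cvg_coord.
exists u; split.
  apply: (@subdifferential_closed _ _ G _ V _ (fun k => x k.+1) t) => //.
  - exact: SG.
  - apply: cvg_rV => c.
    rewrite (_ : (fun k => x k.+1 ord0 c) =
      (fun k => (x k.+1 - x k)%R ord0 c + x k ord0 c)%R); last first.
      by apply/funext => k; rewrite !mxE subrK.
    rewrite -[X in _ --> X]add0r.
    by apply: cvgD; [exact: toV|exact: cvg_coord].
  - move=> c.
    rewrite (_ : (fun k => t k ord0 c) =
      (fun k => (t k - s k)%R ord0 c + s k ord0 c)%R); last first.
      by apply/funext => k; rewrite !mxE subrK.
    by rewrite -[X in _ --> X]add0r; apply: cvgD; [exact: toV|].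
  - exact: filterE.
apply: (@subdifferential_closed _ _ H _ V _ x s) => //.
  exact: SH.
exact: filterE.
Qed.

(** * The mean selector and the algorithm *)

Section probability_lemmas.
Context {d d'} {Omega : measurableType d} {T : measurableType d'} {R : realType}
  (P : probability Omega R).

Lemma independent_rvs_pair {I : finType} (X : I -> {RV P >-> T}) i j B B' :
  independent_rvs X -> i != j -> measurable B -> measurable B' ->
  P (X i @^-1` B `&` X j @^-1` B') = P (X i @^-1` B) * P (X j @^-1` B').
Proof.
move=> indX ij mB mB'.
have := indX [set i; j]%SET (fun l => if l == i then B else B').
rewrite big_setU1 ?inE//= big_set1 eqxx eq_sym (negbTE ij) => <-.
  congr (P _); rewrite eqEsubset; split => x /=.
    move=> [xB xB'] l; rewrite /= !inE => /orP[/eqP->|/eqP->]; first by rewrite eqxx.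
    by rewrite eq_sym (negbTE ij).
  move=> h; split; first by have := h i; rewrite /= !inE eqxx; apply.
  by have := h j; rewrite /= !inE eqxx orbT eq_sym (negbTE ij); apply.
by move=> l _; case: ifP.
Qed.

Lemma integrable_comp_rv (X : {RV P >-> T}) (f : T -> \bar R) :
  (distribution P X).-integrable [set: T] f ->
  P.-integrable [set: Omega] (f \o X).
Proof.
move=> /integrableP[mf fint]; apply/integrableP; split.
  exact: (measurableT_comp mf).
rewrite -[ltLHS](@ge0_integral_distribution _ _ _ _ _ P X (abse \o f))//.
  exact: measurableT_comp.
by move=> y; exact: abse_ge0.
Qed.

End probability_lemmas.

(** Both components are measurable for the sigma-algebra that [G] generates,
hence so is the pair. *)
Lemma sigma_pair_preimage {d1 d2} {Omega : pointedType} {T1 : measurableType d1}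
    {T2 : measurableType d2} (G : set (set Omega)) (X1 : Omega -> T1)
    (X2 : Omega -> T2) :
  (forall A, measurable A -> <<s G >> (X1 @^-1` A)) ->
  (forall A, measurable A -> <<s G >> (X2 @^-1` A)) ->
  forall E : set (T1 * T2), measurable E ->
    <<s G >> ((fun x => (X1 x, X2 x)) @^-1` E).
Proof.
move=> m1 m2 E mE.
have := @measurable_fun_pair _ _ _ (g_sigma_algebraType G) T1 T2 X1 X2.
move=> /(_ _ _ measurableT E mE); rewrite setTI; apply.
- by move=> _ A mA; rewrite setTI; exact: m1.
- by move=> _ A mA; rewrite setTI; exact: m2.
Qed.

Lemma closed_setX {T1 T2 : topologicalType} (A : set T1) (B : set T2) :
  closed A -> closed B -> closed (A `*` B).
Proof.
move=> cA cB.
rewrite (_ : A `*` B = fst @^-1` A `&` snd @^-1` B)//.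
by apply: closedI; apply: preimage_closed => // p _; [exact: cvg_fst|exact: cvg_snd].
Qed.

Section integrands.
Context {d} {Omega : measurableType d} {R : realType} {m n : nat}
  (P : probability Omega R) (Z : {RV P >-> borel 'rV[R]_n})
  (S : set 'rV[R]_m).
Local Notation mu := (distribution P Z).
Local Notation Xi := (measure_support mu).

Lemma expected_value_fin (g : 'rV[R]_m -> 'rV[R]_n -> \bar R) v :
  convex_integrand Z S g -> S v -> expected_value Z g v \is a fin_num.
Proof. by move=> cg Sv; apply: integrable_fin_num (integrand_integrable cg Sv). Qed.

Lemma expected_value_pinfty (g : 'rV[R]_m -> 'rV[R]_n -> \bar R) v :
  convex_integrand Z S g -> ~ S v -> expected_value Z g v = +oo.
Proof.
move=> cg Sv; rewrite /expected_value.
under eq_integral do rewrite (integrand_pinfty cg) => [|[]//].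
by rewrite integral_cst// [X in _ * X](_ : _ = 1) ?mule1//; exact: probability_setT.
Qed.

Variable tau : 'rV[R]_m -> 'rV[R]_n -> 'rV[R]_m.
Hypothesis S_closed : closed S.
Hypothesis tau_measurable :
  measurable_fun (S `*` Xi : set (borel ('rV[R]_m * 'rV[R]_n)%type))
    (fun p => tau p.1 p.2 : borel 'rV[R]_m).
Variable tautilde : 'rV[R]_n -> R.
Hypothesis tautilde_measurable : measurable_fun [set: borel 'rV[R]_n] tautilde.
Hypothesis tautilde_integrable :
  P.-integrable [set: Omega] (fun x => (tautilde (Z x) ^+ 2)%:E).
Hypothesis tau_bound :
  forall w z, S w -> Xi z -> (enorm (tau w z) <= tautilde z)%R.

(** The selector is measurable and bounded by [tautilde] on [S `*` Xi];
replacing its coordinates by 0 elsewhere makes both properties global. *)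
Definition selector_coord (c : 'I_m) (p : borel 'rV[R]_m * borel 'rV[R]_n) : R :=
  ((fun p => tau p.1 p.2 ord0 c) \_ (S `*` Xi)) p.

Lemma selector_coordE c v z : S v -> Xi z ->
  selector_coord c (v, z) = tau v z ord0 c.
Proof. by move=> Sv Xz; rewrite /selector_coord patchT// inE. Qed.

Lemma measurable_selector_coord c :
  measurable_fun [set: borel 'rV[R]_m * borel 'rV[R]_n] (selector_coord c).
Proof.
have mSX : measurable (S `*` Xi : set (borel ('rV[R]_m * 'rV[R]_n)%type)).
  have cc : closed (S `*` Xi) by apply: closed_setX => //; exact: closed_measure_support.
  rewrite -[S `*` Xi]setCK; apply: measurableC; apply: sub_sigma_algebra.
  exact: closed_openC.
have mc : measurable_fun (S `*` Xi : set (borel ('rV[R]_m * 'rV[R]_n)%type))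
    (fun p => tau p.1 p.2 ord0 c).
  apply: (@measurableT_comp _ _ _ _ _ _ (fun u : borel 'rV[R]_m => u ord0 c)) => //.
  by apply: borel_continuous; exact: coord_continuous.
have mc' := (measurable_restrictT _ mSX).1 mc.
apply: (measurableT_comp mc' (borel_prod _ _)); exact: rV_second_countable.
Qed.

Lemma selector_coord_le c v z : (`|selector_coord c (v, z)| <= `|tautilde z|)%R.
Proof.
have [[/= Sv Xz]|nSX] := pselect ((S `*` Xi) (v, z)).
  rewrite selector_coordE// (le_trans (coord_le_enorm _ _))//.
  by rewrite (le_trans (tau_bound Sv Xz))// ler_norm.
by rewrite /selector_coord patchN ?normr0// notin_setE.
Qed.

Lemma tautilde_sqr_integrable :
  mu.-integrable [set: borel 'rV[R]_n] (fun z => (tautilde z ^+ 2)%:E).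
Proof.
apply: (integrable_pushforward (measurable_funPT Z)) => //.
by apply/measurable_EFinP; exact: measurable_funX.
Qed.

Definition mean_selector (v : 'rV[R]_m) : 'rV[R]_m :=
  (\row_c partial_mean mu (selector_coord c) v)%R.

(** Integrate the subgradient inequality of [h (., Z)] at [v]. It holds at every
outcome: off the support the right-hand side is [+oo]. *)
Lemma mean_selector_subgradient (h : 'rV[R]_m -> 'rV[R]_n -> \bar R) v :
  convex_integrand Z S h ->
  (forall w z, S w -> Xi z -> subdifferential (h ^~ z) w (tau w z)) ->
  S v -> subdifferential (expected_value Z h) v (mean_selector v).
Proof.
move=> ch htau Sv; split.
  by rewrite /effective_domain/= ltey_eq (expected_value_fin ch).
move=> x; have [Sx|Sx] := pselect (S x); last first.
  by rewrite (expected_value_pinfty ch Sx) leey.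
have sel_int c : P.-integrable [set: Omega]
    (fun y => (selector_coord c (v, Z y))%:E).
  apply: (integrable_comp_rv (f := fun z => (selector_coord c (v, z))%:E)).
  exact: (section_integrable (measurable_selector_coord c)
    (selector_coord_le c) tautilde_sqr_integrable).
have sint c : P.-integrable [set: Omega]
    (fun y => ((x - v)%R ord0 c)%:E * (selector_coord c (v, Z y))%:E).
  exact: integrableZl.
have -> : (dot (x - v)%R (mean_selector v))%:E =
    \int[P]_y (\sum_c ((x - v)%R ord0 c)%:E * (selector_coord c (v, Z y))%:E).
  rewrite integral_sum// /dot -sumEFin; apply: eq_bigr => c _.
  rewrite integralZl// EFinM; congr (_ * _).
  rewrite mxE -(partial_meanE (measurable_selector_coord c)
    (selector_coord_le c) tautilde_sqr_integrable).
  rewrite (integral_distribution (f := fun z => (selector_coord c (v, z))%:E))//.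
    apply/measurable_EFinP.
    exact: (measurableT_comp (measurable_selector_coord c) (measurable_pair1 _)).
  exact: sel_int.
rewrite /expected_value -integralD//; last 2 first.
- exact: integrand_integrable ch _ Sv.
- by apply: integrable_sum => // c _; exact: sint.
apply: le_integral => //.
- apply: integrableD => //; first exact: integrand_integrable ch _ Sv.
  by apply: integrable_sum => // c _; exact: sint.
- exact: integrand_integrable ch _ Sx.
move=> y _; have [Xy|Xy] := pselect (Xi (Z y)); last first.
  by rewrite (integrand_pinfty ch (w := x)) ?leey// => -[].
have [_ /(_ x)] := htau v (Z y) Sv Xy; apply: le_trans.
rewrite leeD2l// /dot -sumEFin; apply: lee_sum => c _.
by rewrite selector_coordE// EFinM.
Qed.

Variables (N : nat -> nat) (N_gt0 : forall k, (0 < N k)%N)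
  (X : forall k, 'I_(N k) -> {RV P >-> borel 'rV[R]_n})
  (w : nat -> {RV P >-> borel 'rV[R]_m}).

Lemma sample_average_error k x :
  S (w k x) -> (forall i, Xi (X (k := k) i x)) ->
  (enorm (sample_average X w tau k x - mean_selector (w k x)) ^+ 2 =
  \sum_c ((N k)%:R^-1 * \sum_(i < N k) selector_coord c (w k x, X i x)
           - partial_mean mu (selector_coord c) (w k x)) ^+ 2)%R.
Proof.
move=> Sw XiX; rewrite enorm_sqr; apply: eq_bigr => c _.
rewrite -expr2 !mxE summxE; congr ((_ * _ - _) ^+ 2)%R.
by apply: eq_bigr => i _; rewrite selector_coordE.
Qed.

(** At step [k] the conditioning variable is [w k], which belongs to the past,
and pairs of samples belong to the batch. *)
Lemma dca_error_summable (G : 'rV[R]_m -> \bar R) :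
  online_stochastic_dca Z X w S G tau ->
  \sum_(1 <= k <oo) ((N k)%:R^-1)%:E < (+oo : \bar R) ->
  {ae P, forall x, \sum_(1 <= k <oo)
    (\sum_c ((N k)%:R^-1 * \sum_(i < N k) selector_coord c (w k x, X i x)
             - partial_mean mu (selector_coord c) (w k x)) ^+ 2)%:E < +oo}.
Proof.
move=> dca Nsum.
have /choice[C CP] c := sample_error_le (measurable_selector_coord c)
  (selector_coord_le c) tautilde_sqr_integrable.
pose err c k x := ((N k)%:R^-1 * \sum_(i < N k) selector_coord c (w k x, X i x)
             - partial_mean mu (selector_coord c) (w k x))%R.
have merr c k : measurable_fun [set: Omega] (fun x => err c k x ^+ 2)%R.
  apply: measurable_funX; apply: measurable_funB.
    apply: measurable_funM => //; apply: measurable_sum => i.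
    exact: (measurableT_comp (measurable_selector_coord c)
      (measurable_funPT (pair_rv (w k) (X i)))).
  apply: (measurableT_comp _ (measurable_funPT (w k))).
  exact: (measurable_partial_mean _ (measurable_selector_coord c)).
apply: (ae_summable (u := fun k => (N k)%:R^-1%R) (C := (\sum_c `|C c|)%R)
  (e := fun k x => (\sum_c err c k x ^+ 2)%R)) => //.
- by move=> k; exact: measurable_sum.
- by move=> k x; apply: sumr_ge0 => c _; exact: sqr_ge0.
- exact: sumr_ge0.
move=> k.
under eq_integral do rewrite -sumEFin.
rewrite ge0_integral_sum//; last 2 first.
- by move=> c; exact/measurable_EFinP.
- by move=> c x _; rewrite lee_fin sqr_ge0.
rewrite mulr_suml -sumEFin; apply: lee_sum => c _.
apply: (@le_trans _ _ (C c * (N k)%:R^-1)%:E); last first.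
  by rewrite lee_fin ler_wpM2r ?invr_ge0// ler_norm.
apply: CP => //.
- by move=> i B mB; rewrite (dca_sample_law dca).
- move=> i j ij B B' mB mB'.
  exact: (independent_rvs_pair (dca_sample_indep dca (k := k)) ij mB mB').
move=> i j B E mB mE; apply: (dca_past_indep dca (k := k)).
  apply: sub_sigma_algebra; right; exists k => //=.
  by exists B => //; rewrite setTI.
apply: sigma_pair_preimage => // A mA; apply: sub_sigma_algebra.
  by exists i => //; exists A => //; rewrite setTI.
by exists j => //; exists A => //; rewrite setTI.
Qed.

End integrands.

(** * The convergence theorem *)

Theorem theorem2 (R : realType) (m n : nat)
  (d : measure_display) (Omega : measurableType d) (P : probability Omega R)
  (P_complete : measure_is_complete P)
  (Z : {RV P >-> borel 'rV[R]_n})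
  (Xi : set 'rV[R]_n) (Xi_def : Xi = measure_support (distribution P Z))
  (S : set 'rV[R]_m)
  (S_nonempty : S !=set0) (S_compact : compact S) (S_convex : convex_set S)
  (g h : 'rV[R]_m -> 'rV[R]_n -> \bar R)
  (g_integrand : convex_integrand Z S g)
  (h_integrand : convex_integrand Z S h)
  (G H F : 'rV[R]_m -> \bar R)
  (G_def : G = expected_value Z g) (H_def : H = expected_value Z h)
  (F_def : F = dc_difference G H)
  (dom_h : forall z, Xi z -> dom_subdifferential (h ^~ z) = S)
  (rho_gt0 : 0 < strong_convexity_modulus H + strong_convexity_modulus G)
  (tau : 'rV[R]_m -> 'rV[R]_n -> 'rV[R]_m)
  (tau_measurable :
     measurable_fun (S `*` Xi : set (borel ('rV[R]_m * 'rV[R]_n)%type))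
       (fun p => tau p.1 p.2 : borel 'rV[R]_m))
  (tau_subgradient : forall w z, S w -> Xi z ->
     subdifferential (h ^~ z) w (tau w z))
  (tautilde : 'rV[R]_n -> R)
  (tautilde_measurable :
     measurable_fun [set: borel 'rV[R]_n] tautilde)
  (tautilde_integrable :
     P.-integrable [set: Omega] (fun x => (tautilde (Z x) ^+ 2)%:E))
  (tau_bound : forall w z, S w -> Xi z -> (enorm (tau w z) <= tautilde z)%R)
  (F_bounded : ereal_sup [set `|F w| | w in S] < +oo)
  (N : nat -> nat) (N_gt0 : forall k, (0 < N k)%N)
  (N_summable : \sum_(1 <= k <oo) ((N k)%:R^-1)%:E < (+oo : \bar R))
  (X : forall k, 'I_(N k) -> {RV P >-> borel 'rV[R]_n})
  (w : nat -> {RV P >-> borel 'rV[R]_m})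
  (w_generated : online_stochastic_dca Z X w S G tau) :
  [/\ exists Finf : {RV P >-> R},
        P.-integrable [set: Omega] (EFin \o Finf) /\
        {ae P, forall x, F (w k x) @[k --> \oo] --> (Finf x)%:E},
      {ae P, forall x,
        \sum_(1 <= k <oo)
          (enorm ((w k.+1 x : 'rV[R]_m) - (w k x : 'rV[R]_m))%R ^+ 2)%:E < +oo} &
      exists L : set Omega,
        [/\ measurable L, P L = 1 &
          forall x, L x -> forall v : 'rV[R]_m,
            cluster ((fun k => w k x : 'rV[R]_m) @ \oo) v ->
            critical_point G H v]].

Proof.
subst Xi; set Xi := measure_support (distribution P Z) in
  tau_measurable tau_subgradient tau_bound.
have S_closed : closed S by apply: compact_closed => //; exact: norm_hausdorff.
have Gfin v : S v -> G v \is a fin_num.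
  by move=> Sv; rewrite G_def (expected_value_fin g_integrand).
have Hfin v : S v -> H v \is a fin_num.
  by move=> Sv; rewrite H_def (expected_value_fin h_integrand).
have Gout v : ~ S v -> G v = +oo.
  by move=> Sv; rewrite G_def (expected_value_pinfty g_integrand).
have G_lsc : lower_semicontinuous G.
  by rewrite G_def; exact: expected_value_lsc g_integrand.
have H_lsc : lower_semicontinuous H.
  by rewrite H_def; exact: expected_value_lsc h_integrand.
pose f v := (fine (G v) - fine (H v))%R.
have FE v : S v -> F v = (f v)%:E.
  by move=> Sv; rewrite F_def /dc_difference -(fineK (Gfin v Sv))
    -(fineK (Hfin v Sv)).
have [M fM] : exists M, forall v, S v -> (`|f v| <= M)%R.
  exists (fine (ereal_sup [set `|F w| | w in S])) => v Sv.
  have le : `|F v| <= ereal_sup [set `|F w| | w in S].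
    by apply: ereal_sup_ubound; exists v.
  rewrite -lee_fin fineK; first by rewrite -abse_EFin -FE.
  by rewrite ge0_fin_numE// (le_trans _ le).
have [muG [muH [muG0 muH0 mu0 cG cH]]] := strong_convexity_moduli rho_gt0.
pose mean v := mean_selector Z S tau v.
have meanH v : S v -> subdifferential H v (mean v).
  move=> Sv; rewrite H_def.
  exact: (mean_selector_subgradient S_closed tau_measurable
    tautilde_measurable tautilde_integrable tau_bound h_integrand tau_subgradient).
have ae_Xi : {ae P, forall x k (i : 'I_(N k)), Xi (X k i x)}.
  apply: ae_foralln => k; apply: filter_forall => i.
  have mXi : measurable (Xi : set (borel 'rV[R]_n)).
    by apply: borel_closed; exact: closed_measure_support.
  exists (X k i @^-1` (~` Xi)); split => //.
    by apply: measurable_funPTI; exact: measurableC.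
  rewrite -[LHS]/(distribution P (X k i) (~` Xi)).
  rewrite (dca_sample_law w_generated); last exact: measurableC.
  exact: measure_supportC.
have ae_err : {ae P, forall x, \sum_(1 <= k <oo)
    (\sum_c ((N k)%:R^-1 *
        \sum_(i < N k) selector_coord Z S tau c (w k x, X k i x)
      - partial_mean (distribution P Z) (selector_coord Z S tau c) (w k x))
        ^+ 2)%:E < +oo}.
  exact: (dca_error_summable S_closed tau_measurable tautilde_measurable
    tautilde_integrable tau_bound N_gt0 w_generated N_summable).
pose t k x := sample_average X w tau k x.
(* When all samples lie in the support, every iterate after the initial one
   minimises a function that is +oo outside S, hence lies in S. *)
have run x : (forall k (i : 'I_(N k)), Xi (X k i x)) ->
    (forall k, S (w k x)) /\ (forall k, subdifferential G (w k.+1 x) (t k x)).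
  move=> XiX.
  have step k : argmin (fun v => G v - (dot (t k x) v)%:E) (w k.+1 x).
    exact: (dca_step w_generated).
  have Sw k : S (w k x).
    case: k => [|k]; first exact: dca_start w_generated x.
    apply: contrapT => nS; have [v Sv] := S_nonempty.
    have := step k v; rewrite /= (Gout _ nS) -(fineK (Gfin v Sv)).
    by rewrite -EFinB leye_eq.
  by split => // k; apply: argmin_linear_subdifferential => //; exact: Gfin.
have key : {ae P, forall x, [/\ forall k, S (w k x),
    forall k, subdifferential G (w k.+1 x) (t k x),
    \sum_(1 <= k <oo) (enorm (t k x - mean (w k x)) ^+ 2)%:E < +oo,
    cvgn (fun k => f (w k x)) &
    \sum_(1 <= k <oo) (enorm ((w k.+1 x : 'rV[R]_m) - w k x)%R ^+ 2)%:E < +oo]}.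
  apply: filterS2 ae_Xi ae_err => x XiX err.
  have [Sw Gt] := run x XiX.
  have efin : \sum_(1 <= k <oo) (enorm (t k x - mean (w k x)) ^+ 2)%:E < +oo.
    apply: le_lt_trans err; apply: lee_nneseries => [k _ _|k _].
      by rewrite lee_fin sqr_ge0.
    by rewrite lee_fin /t /mean (sample_average_error tau (Sw k) (XiX k)).
  have [] := @bounded_descent R (fun k => f (w k x))
    (fun k => (muG + muH)^-1 * enorm (t k x - mean (w k x)) ^+ 2)%R
    (fun k => (muG + muH) / 4 * enorm ((w k.+1 x : 'rV[R]_m) - w k x) ^+ 2)%R M.
  - by move=> k; exact: fM.
  - by move=> k; rewrite mulr_ge0 ?sqr_ge0// invr_ge0 ltW.
  - by move=> k; rewrite mulr_ge0 ?sqr_ge0// divr_ge0// ltW.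
  - move=> k; apply: dc_descent => //; [exact: Gfin|exact: Gfin|exact: Hfin|exact: Hfin|].
    exact: meanH.
  - apply: (@summableZ _ (muG + muH)^-1%R _ _ _ _ _ efin) => //.
      by rewrite invr_ge0 ltW.
    by move=> k; exact: sqr_ge0.
  move=> fcvg dfin; split => //.
  apply: (@summableZ _ (4 / (muG + muH))%R _ _ _ _ _ dfin).
  - by rewrite divr_ge0// ltW.
  -    by move=> k; rewrite mulr_ge0 ?sqr_ge0// divr_ge0// ltW.
  by move=> k; rewrite /=; field; rewrite gt_eqF.
split.
- have mf k : measurable_fun [set: Omega] (fun x => f (w k x)).
    apply: measurable_funB; apply: (measurableT_comp (fine_measurable _)) => //.
      exact: (measurableT_comp (borel_lower_semicontinuous G_lsc)).
    exact: (measurableT_comp (borel_lower_semicontinuous H_lsc)).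
  have [|Finf [Fint Fcvg]] := @ae_limit_rv _ _ _ P (fun k x => f (w k x)) M mf.
    by apply: filterS key => x [Sw _ _ fcvg _]; split => // k; exact: fM.
  exists Finf; split => //; apply: filterS2 key Fcvg => x [Sw _ _ _ _] fx.
  rewrite (_ : (fun k => F (w k x)) = (fun k => (f (w k x))%:E)).
    by apply/fine_cvgP; split => //; exact: nearW.
  by apply/funext => k; rewrite FE.
- by apply: filterS key => x [].
- have [L [mL PL LQ]] := ae_probability1 key; exists L; split => // x /LQ.
  move=> [Sw Gt efin _ dfin] v clv.
  (* The bound of partial_mean_bound for |tau| <= tautilde. *)
  pose B := (1 + fine (\int[distribution P Z]_z (tautilde z ^+ 2)%:E))%R.
  apply: (@cluster_critical_point _ _ S G H (fun k => w k x) (fun k => mean (w k x))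
    (fun k => t k x) B) => //.
  - by move=> u /Gfin; rewrite /effective_domain/= ltey_eq => ->.
  - by move=> u /Hfin; rewrite /effective_domain/= ltey_eq => ->.
  - by move=> k; exact: meanH.
  - move=> k c; rewrite mxE; apply: partial_mean_bound.
    + exact: measurable_selector_coord.
    + exact: (selector_coord_le tau_bound).
    + exact: tautilde_sqr_integrable.
  - move=> c; apply: summable_coord_cvg0 efin => k; rewrite enorm_sqr.
    exact: coord_sqr_le.
  - move=> c; apply: summable_coord_cvg0 dfin => k; rewrite enorm_sqr.
    exact: coord_sqr_le.
Qed.
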